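(* Let $\rho\in C_c^\infty([0,\frac12])$ with $\rho=1$ on $[0,\frac14]$. Then there exists a constant $C>0$, independent of $u$ and of $x$, such that for each $x\in\mathbb{R}^2\setminus\{0\}$ the inequality $$\left|\int_{\mathbb{R}^2}\big(y\cdot DG(x)\big)\,A(D)u(y)\,\rho\!\left(\frac{|y|}{|x|}\right)dy\right|\leq\frac{C}{|x|}\int_{\left\{y\in\mathbb{R}^2:\ \frac14\leq\frac{|y|}{|x|}\leq\frac12\right\}}|A(D)u(y)|\,dy$$ holds for all $u\in C_c^\infty(\mathbb{R}^2,\mathbb{R}^2)$, where $y\cdot DG(x)=\sum_{i=1}^2y_i\,\partial_{x_i}G(x)$.
   Context: For $u=(u_1,u_2)\in C_c^\infty(\mathbb{R}^2,\mathbb{R}^2)$, the operator $A(D)$ (a representation of the symmetric gradient) is defined by $$A(D)u:=\begin{bmatrix}\partial_1u_1\\ \partial_2u_1+\partial_1u_2\\ \partial_2u_2\end{bmatrix}.$$ For $x=(x_1,x_2)\in\mathbb{R}^2\setminus\{0\}$, the $2\times3$ matrix-valued function $G$ (a scalar multiple of a Green's function for $A(D)$) is $$G(x):=\frac{1}{|x|^2}\begin{bmatrix}x_1&x_2&-x_1\\-x_2&x_1&x_2\end{bmatrix}.$$ Thus $y\cdot DG(x)$ is a $2\times3$ matrix acting on the vector $A(D)u(y)\in\mathbb{R}^3$. The notation $\rho\in C_c^\infty([0,\frac12])$ means that $\rho$ is a smooth function on $[0,\infty)$ supported in $[0,\frac12]$. The constant $C$ may depend on $\rho$. *)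

(* Defs.v *)
From mathcomp Require Import all_boot all_order all_algebra.
From mathcomp Require Import all_classical all_reals all_analysis.

Set Implicit Arguments.
Unset Strict Implicit.
Unset Printing Implicit Defensive.

Import Order.TTheory GRing.Theory Num.Theory.
Import numFieldNormedType.Exports.

Local Open Scope classical_set_scope.
Local Open Scope ring_scope.

(* The plane R^2 is R * R, so that it carries the product measure.  The
   library norm on R * R and on matrices is the max norm, hence the explicit
   Euclidean norms pnorm and vnorm. *)

Definition pnorm (R : realType) (x : R * R) : R :=
  Num.sqrt (x.1 ^+ 2 + x.2 ^+ 2).

Definition vnorm (R : realType) (n : nat) (v : 'cV[R]_n) : R :=
  Num.sqrt (\sum_(i < n) v i 0 ^+ 2).

Definition lebesgue2 (R : realType) :=
  ((@lebesgue_measure R) \x (@lebesgue_measure R))%E.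
Arguments lebesgue2 : clear implicits.

Definition vintegral (R : realType) (n : nat) (f : R * R -> 'cV[R]_n) :
    'cV[R]_n :=
  \col_(i < n) \int[lebesgue2 R]_y f y i 0.

Definition basis2 (R : realType) (i : 'I_2) : R * R :=
  if i == 0 then (1, 0) else (0, 1).

Definition partial (R : realType) (W : normedModType R) (i : 'I_2)
    (f : R * R -> W) : R * R -> W :=
  'D_(basis2 R i) f.

(* 'D_v is a total operator, so existence of every iterated partial
   derivative is required separately from its continuity. *)
Definition smooth2 (R : realType) (W : normedModType R) (f : R * R -> W) :
    Prop :=
  forall s : seq 'I_2, let g := foldr (@partial R W) f s in
    continuous g /\ forall (i : 'I_2) (x : R * R), derivable g x (basis2 R i).

Definition test_field (R : realType) (u : R * R -> R * R) : Prop :=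
  smooth2 u /\ compact (closure [set x | u x != 0]).

Definition smooth1 (R : realType) (g : R -> R) : Prop :=
  forall (n : nat) (t : R), derivable (derive1n n g) t 1.

(* Only the values of rho on [0, +oo[ matter; smoothness on that closed
   half-line means being the restriction of a smooth function on R. *)
Definition smooth_half_line (R : realType) (rho : R -> R) : Prop :=
  exists2 g : R -> R, smooth1 g & {in `[0, +oo[, rho =1 g}.

Definition cutoff (R : realType) (rho : R -> R) : Prop :=
  [/\ smooth_half_line rho,
      closure [set t | 0 <= t /\ rho t != 0] `<=` `[0, 2^-1] &
      {in `[0, 4^-1], forall t, rho t = 1}].

Definition mx_of_rows (R : realType) (m n : nat) (rows : seq (seq R)) :
    'M[R]_(m, n) :=
  \matrix_(i < m, j < n) nth 0 (nth [::] rows i) j.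

Definition AD (R : realType) (u : R * R -> R * R) (y : R * R) : 'cV[R]_3 :=
  let u1 : R * R -> R^o := fun z => (u z).1 in
  let u2 : R * R -> R^o := fun z => (u z).2 in
  mx_of_rows 3 1 [:: [:: partial 0 u1 y];
                     [:: partial 1 u1 y + partial 0 u2 y];
                     [:: partial 1 u2 y]].

Definition G (R : realType) (x : R * R) : 'M[R]_(2, 3) :=
  (pnorm x ^+ 2)^-1 *: mx_of_rows 2 3 [:: [:: x.1; x.2; - x.1];
                                          [:: - x.2; x.1; x.2]].

Definition ydotDG (R : realType) (y x : R * R) : 'M[R]_(2, 3) :=
  y.1 *: partial 0 (@G R) x + y.2 *: partial 1 (@G R) x.

(* Main.v *)
Require Import Defs.
From mathcomp Require Import all_boot all_order all_algebra.
From mathcomp Require Import all_classical all_reals all_analysis.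
From mathcomp Require Import ring lra.

(** The estimate looks like it needs a Korn-Poincare inequality on the annulus
    r/4 <= |y| <= r/2, where r = |x|, but an Airy stress function gives it
    directly.

    A row of y.DG(x) has three entries w1, w2, w3, linear in y; read as the
    symmetric matrix (w1, w2; w2, w3) it is trace free and, since G is a Green
    function of A(D), divergence free. In the plane such a matrix is the
    rotated Hessian (d22 p, - d12 p, d11 p) of a scalar p, here a harmonic
    cubic polynomial with coefficients of size 1/r^2 ([cubic],
    [ydotDG_mulmx]). Put psi(y) = rho(|y|/r) p(y). The rotated Hessian of psi
    is smooth, compactly supported and divergence free, so its integral
    against the symmetric gradient A(D)u vanishes: one integration by parts
    and the equality of the mixed second derivatives of u suffice
    ([integral_airy]).

    Subtract that integral. The remaining coefficient, rho w minus the rotated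
    Hessian of rho p, contains only the terms in which at least one derivative
    falls on the cutoff ([defect] below). It is therefore supported in the
    annulus, where scaling bounds it by a constant over r ([defect_bounds]),
    and the triangle inequality finishes the proof ([integral_cutoff_cubic]).

    Two points need care. The map y |-> rho(|y|/r) is handled as
    s((|y|/r)^2) with s(t) = rho(sqrt t), which is twice continuously
    differentiable on the whole line because rho is constant near 0
    ([cutoff_profile]). And the integrals are over the product measure, so
    that integrating a partial derivative is Fubini plus the fundamental
    theorem of calculus on lines ([integral_partial_eq0]). *)

Set Implicit Arguments.
Unset Strict Implicit.
Unset Printing Implicit Defensive.

Import Order.TTheory GRing.Theory Num.Theory.
Import numFieldNormedType.Exports.

Local Open Scope classical_set_scope.
Local Open Scope ring_scope.

(** * Measurability and integrability of continuous functions on the plane *)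

(** The sigma-algebra of the plane is the product one, whereas continuity is
    about the product topology; the two agree because every open set is the
    union of the rectangles with rational corners that it contains. *)
Lemma open_measurable2 (R : realType) (U : set (R * R)) :
  open U -> measurable (U : set (measurableTypeR R * measurableTypeR R)).
Proof.
move=> oU.
pose rect (q : (rat * rat) * (rat * rat)) : set (R * R) :=
  `]ratr q.1.1, ratr q.1.2[ `*` `]ratr q.2.1, ratr q.2.2[.
have -> : U = \bigcup_q (if `[< rect q `<=` U >] then rect q else set0).
  apply/seteqP; split => [y Uy|y [q _]]; last first.
    by case: ifPn => // /asboolP qU /qU.
  have /nbhs_ballP[e /= e0 yeU] : nbhs y U by exact: open_nbhs_nbhs.
  have between (t : R) : exists q : rat * rat,
      [/\ t - e < ratr q.1, ratr q.1 < t, t < ratr q.2 & ratr q.2 < t + e].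
    have [|a] := @rat_in_itvoo R (t - e) t; first by rewrite ltrBlDr ltrDl.
    have [|b] := @rat_in_itvoo R t (t + e); first by rewrite ltrDl.
    rewrite !in_itv/= => /andP[? ?] /andP[? ?].
    by exists (a, b).
  have [p [p1 p2 p3 p4]] := between y.1.
  have [q [q1 q2 q3 q4]] := between y.2.
  exists (p, q) => //; case: ifPn => [_|/asboolPn].
    by split => /=; rewrite in_itv/= ?p2 ?p3 ?q2 ?q3.
  case => z [] /=; rewrite !in_itv/= => /andP[z1 z2] /andP[z3 z4].
  apply: yeU; split; rewrite /= /ball/= ltr_norml.
    by apply/andP; split; lra.
  by apply/andP; split; lra.
apply: countable_bigcupT_measurable => // q.
case: ifPn => // _; exact: measurableX.
Qed.

Lemma continuous_measurable_fun2 (R : realType) (f : R * R -> R) :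
  continuous f ->
  measurable_fun (setT : set (measurableTypeR R * measurableTypeR R)) f.
Proof.
move=> /continuousP cf.
apply: (measurability _ (measurable_realfun.RGenOpens.measurableE R)).
move=> _ [_ [a [b ->] <-]]; rewrite setTI; apply: open_measurable2.
exact/cf/interval_open.
Qed.

Lemma integrable_continuous_square (R : realType) (L : R) (f : R * R -> R) :
  continuous f ->
  (lebesgue2 R).-integrable (`[- L, L] `*` `[- L, L] : set (R * R)) (EFin \o f).
Proof.
move=> cf; set Q : set (R * R) := _ `*` _.
have cQ : compact Q by apply: compact_setX; exact: segment_compact.
have mf := continuous_measurable_fun2 cf.
apply: measurable_bounded_integrable.
- by apply: measurableX; exact: measurable_itv.
- rewrite [ltLHS](product_measure1E (@lebesgue_measure R)
    (@lebesgue_measure R))//.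
  have Qfin : (@lebesgue_measure R (`[(- L)%R, L]%classic : set R) < +oo)%E.
    by rewrite lebesgue_measure_itv/=; case: ifPn => // _; rewrite ltry.
  by apply: lte_mul_pinfty => //; rewrite ge0_fin_numE.
- exact: measurable_funTS.
- have /compact_bounded[M [_ mrt]] := continuous_compact
    (continuous_subspaceT cf) cQ.
  by exists M; split; rewrite ?num_real// => ? ? ? ?; exact: mrt.
Qed.

(** Here and below, `|y| is the max norm on R * R, so that vanishing for
    L <= `|y| means being supported in a square. *)
Lemma integrable_continuous_vanish (R : realType) (L : R) (f : R * R -> R) :
  continuous f -> (forall y, L <= `|y| -> f y = 0) ->
  (lebesgue2 R).-integrable setT (EFin \o f).
Proof.
move=> cf f0; pose Q : set (R * R) := `[- L, L] `*` `[- L, L].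
have -> : EFin \o f = (EFin \o f) \_ Q.
  apply/funext => y; rewrite patchE; case: ifPn => //=.
  rewrite notin_setE => Qy; rewrite f0//; have [//|yL] := leP L `|y|.
  case: Qy; have : `|y.1| < L /\ `|y.2| < L.
    by move: yL; rewrite prod_normE/= gt_max => /andP.
  by move=> [y1 y2]; split; rewrite /= in_itv/=; rewrite -ler_norml ltW.
have mQ : measurable (Q : set (measurableTypeR R * measurableTypeR R)).
  by apply: measurableX; exact: measurable_itv.
apply/integrable_restrict => //; rewrite ?setTI ?setIT.
exact: integrable_continuous_square.
Qed.

(** * Directional derivatives, integrals of partial derivatives, mixed derivatives *)

(** A directional derivative only sees the restriction of the function to a
    line. This transfers derivatives between the plane, its horizontal and
    vertical slices, and the parameter of a line. *)
Lemma is_derive_line (R : realFieldType) (V V' W : normedModType R)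
    (f : V -> W) (g : V' -> W) (x v : V) (a w : V') (d : W) :
  (forall h : R, f (h *: v + x) = g (h *: w + a)) ->
  is_derive x v f d -> is_derive a w g d.
Proof.
move=> fg.
have E : (fun h => h^-1 *: ((f \o shift x) (h *: v) - f x)) =
         (fun h => h^-1 *: ((g \o shift a) (h *: w) - g a)).
  apply/funext => h /=; rewrite fg.
  by have := fg 0; rewrite !scale0r !add0r => ->.
by move=> [df <-]; split; rewrite /derivable /derive -E.
Qed.

(** No differentiability of f is required beyond the direction v: along that
    line the claim is the one-variable chain rule. *)
Lemma is_derive_chain (R : realFieldType) (V : normedModType R)
    (f : V -> R) (g : R -> R) (x v : V) (df dg : R) :
  is_derive x v f df -> is_derive (f x) 1 g dg ->
  is_derive x v (g \o f) (dg * df).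
Proof.
move=> xf fxg.
have F0 : is_derive (0 : R) 1 (fun h : R => f (h *: v + x)) df.
  apply: is_derive_line xf => h; congr (f (_ + _)).
  by rewrite addr0 scaler1.
have F0E : f ((0 : R) *: v + x) = f x by rewrite scale0r add0r.
suff : is_derive (0 : R) 1 (g \o (fun h : R => f (h *: v + x))) (dg * df).
  apply: is_derive_line => h /=; by rewrite addr0 scaler1.
have [dF vF] := F0; have [dG vG] := fxg.
have dG' : derivable g (f ((0 : R) *: v + x)) 1 by rewrite F0E.
split.
  apply/derivable1_diffP; apply: differentiable_comp; exact/derivable1_diffP.
by rewrite -derive1E derive1_comp// F0E !derive1E vF vG.
Qed.

Lemma is_derive_slice1 (R : realFieldType) (W : normedModType R)
    (f : R * R -> W) (a b : R) (d : W) :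
  is_derive (a, b) (1, 0) f d -> is_derive a 1 (fun t => f (t, b)) d.
Proof.
by apply: is_derive_line => h; congr f; congr pair => /=; rewrite scaler0 add0r.
Qed.

Lemma is_derive_slice2 (R : realFieldType) (W : normedModType R)
    (f : R * R -> W) (a b : R) (d : W) :
  is_derive (a, b) (0, 1) f d -> is_derive b 1 (fun t => f (a, t)) d.
Proof.
by apply: is_derive_line => h; congr f; congr pair => /=; rewrite scaler0 add0r.
Qed.

Lemma is_derive_continuous (R : realType) (F f : R -> R) :
  (forall x : R, is_derive x 1 F (f x)) -> continuous F.
Proof.
by move=> FE x; apply/differentiable_continuous/derivable1_diffP; case: (FE x).
Qed.

Lemma MVT_everywhere (R : realType) (F f : R -> R) (a b : R) :
  a < b -> (forall x : R, is_derive x 1 F (f x)) ->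
  exists2 c, a < c < b & F b - F a = f c * (b - a).
Proof.
move=> ab FE; have [c] := MVT ab (fun x _ => FE x)
  (continuous_subspaceT (is_derive_continuous FE)).
by rewrite in_itv/=; exists c.
Qed.

Lemma integral_derive_eq0 (R : realType) (L : R) (F f : R -> R) :
  continuous f -> (forall x : R, is_derive x 1 F (f x)) ->
  (forall x, L <= `|x| -> F x = 0 /\ f x = 0) ->
  (\int[@lebesgue_measure R]_x (f x)%:E = 0)%E.
Proof.
move=> cf FE F0; pose K := `|L| + 1.
have K0 : 0 < K by rewrite ltr_wpDl.
have LK : L <= K by rewrite (le_trans (ler_norm L))// lerDl.
have cF := is_derive_continuous FE.
rewrite (_ : (fun x => (f x)%:E) = ((fun x => (f x)%:E) \_ `[- K, K])); last first.
  apply/funext => x; rewrite patchE; case: ifPn => //.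
  rewrite notin_setE /= in_itv/= -ler_norml => /negP; rewrite -ltNge => Kx.
  by rewrite (F0 x _).2// (le_trans LK)// ltW.
rewrite -integral_mkcond (@continuous_FTC2 _ f F).
- rewrite (F0 K _).1 ?(F0 (- K) _).1 ?subee// ?normrN.
    by rewrite (le_trans LK)// ler_norm.
  by rewrite (le_trans LK)// ler_norm.
- by rewrite gtrN.
- exact: continuous_subspaceT.
- split.
  + by move=> x _; case: (FE x).
  + exact/cvg_at_right_filter/cF.
  + exact/cvg_at_left_filter/cF.
- by move=> x _; rewrite derive1E; case: (FE x).
Qed.

Lemma continuous_slice1 (R : realType) (f : R * R -> R) (b : R) :
  continuous f -> continuous (fun a : R => f (a, b)).
Proof.
move=> cf a; apply: (@continuous_comp _ _ _ (fun a => (a, b)) f a); last exact: cf.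
exact: (cvg_pair (@cvg_id _ _) (@cvg_cst _ b _ _ _)).
Qed.

Lemma continuous_slice2 (R : realType) (f : R * R -> R) (a : R) :
  continuous f -> continuous (fun b : R => f (a, b)).
Proof.
by move=> /continuous_curry[_ /(_ a)].
Qed.

(** Integrate first in the variable of the derivative: on each line parallel
    to that axis the fundamental theorem of calculus leaves only boundary
    values, which vanish. *)
Lemma integral_partial_eq0 (R : realType) (i : 'I_2) (L : R)
    (F f : R * R -> R) :
  continuous f -> (forall y, is_derive y (basis2 R i) F (f y)) ->
  (forall y, L <= `|y| -> F y = 0 /\ f y = 0) ->
  \int[lebesgue2 R]_y f y = 0.
Proof.
move=> cf FE F0.
have fint := integrable_continuous_vanish cf (fun y Ly => (F0 y Ly).2).
rewrite /Rintegral.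
case: (altP (i =P 0)) FE => [-> FE|]; last first.
  rewrite /basis2 => /negbTE -> FE.
  rewrite -(integral12_prod_meas1 fint) integral0_eq// => a _.
  apply: (@integral_derive_eq0 _ L _ _ (continuous_slice2 cf)
    (fun b => is_derive_slice2 (FE (a, b)))) => b Lb.
  by apply: F0; rewrite prod_normE/= le_max Lb orbT.
rewrite -(integral21_prod_meas1 fint) integral0_eq// => b _.
apply: (@integral_derive_eq0 _ L _ _ (continuous_slice1 cf)
  (fun a => is_derive_slice1 (FE (a, b)))) => a La.
by apply: F0; rewrite prod_normE/= le_max La.
Qed.

(** Two applications of the mean value theorem, in either order, express the
    second difference of g over a small square as the area times a value of
    g12, and as the area times a value of g21, at points of the square;
    continuity then identifies the two at the corner. *)
Lemma schwarz (R : realType) (g g1 g2 g12 g21 : R * R -> R) :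
  (forall y : R * R, is_derive y (1, 0) g (g1 y)) ->
  (forall y : R * R, is_derive y (0, 1) g (g2 y)) ->
  (forall y : R * R, is_derive y (0, 1) g1 (g12 y)) ->
  (forall y : R * R, is_derive y (1, 0) g2 (g21 y)) ->
  continuous g12 -> continuous g21 -> g12 =1 g21.
Proof.
move=> gE1 gE2 gE12 gE21 c12 c21 [a b].
apply/eqP; rewrite -subr_eq0 -normr_le0; apply/ler_addgt0Pr => e e0.
rewrite add0r; have e20 : 0 < e / 2 by rewrite divr_gt0.
have /nbhs_ballP[d1 /= d10 near1] :
    nbhs (a, b) (fun z => `|g12 (a, b) - g12 z| < e / 2).
  by have /cvgrPdist_lt/(_ _ e20) := c12 (a, b).
have /nbhs_ballP[d2 /= d20 near2] :
    nbhs (a, b) (fun z => `|g21 (a, b) - g21 z| < e / 2).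
  by have /cvgrPdist_lt/(_ _ e20) := c21 (a, b).
pose h := Num.min d1 d2 / 2.
have h0 : 0 < h by rewrite divr_gt0// lt_min d10.
have [hd1 hd2] : h < d1 /\ h < d2.
  have hm : h < Num.min d1 d2 by rewrite ltr_pdivrMr// ltr_pMr ?lt_min ?d10// ltr1n.
  by split; apply: (lt_le_trans hm); rewrite ge_min lexx ?orbT.
have box d s t : h < d -> a < s < a + h -> b < t < b + h -> ball (a, b) d (s, t).
  move=> hd /andP[? ?] /andP[? ?].
  by split; rewrite /ball/= ltr_norml; apply/andP; split; lra.
have ah : a < a + h by rewrite ltrDl.
have bh : b < b + h by rewrite ltrDl.
have [s [t [sI tI D12]]] : exists s t, [/\ a < s < a + h, b < t < b + h &
    g (a + h, b + h) - g (a + h, b) - (g (a, b + h) - g (a, b)) =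
    g12 (s, t) * h * h].
  have [s sI ->] := @MVT_everywhere R (fun s => g (s, b + h) - g (s, b))
    (fun s => g1 (s, b + h) - g1 (s, b)) _ _ ah
    (fun s => is_deriveB (is_derive_slice1 (gE1 (s, b + h)))
                         (is_derive_slice1 (gE1 (s, b)))).
  have [t tI ->] := MVT_everywhere bh (fun t => is_derive_slice2 (gE12 (s, t))).
  by exists s, t; split => //; ring.
have [s' [t' [sI' tI' D21]]] : exists s t, [/\ a < s < a + h, b < t < b + h &
    g (a + h, b + h) - g (a + h, b) - (g (a, b + h) - g (a, b)) =
    g21 (s, t) * h * h].
  have E : g (a + h, b + h) - g (a + h, b) - (g (a, b + h) - g (a, b)) =
      g (a + h, b + h) - g (a, b + h) - (g (a + h, b) - g (a, b)) by ring.
  rewrite E.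
  have [q qI ->] := @MVT_everywhere R (fun t => g (a + h, t) - g (a, t))
    (fun t => g2 (a + h, t) - g2 (a, t)) _ _ bh
    (fun t => is_deriveB (is_derive_slice2 (gE2 (a + h, t)))
                         (is_derive_slice2 (gE2 (a, t)))).
  have [p pI ->] := MVT_everywhere ah (fun s => is_derive_slice1 (gE21 (s, q))).
  by exists p, q; split => //; ring.
have E : g12 (s, t) = g21 (s', t').
  have hn0 := lt0r_neq0 h0.
  by apply: (mulIf hn0); apply: (mulIf hn0); rewrite -D12 -D21.
have := near1 _ (box _ _ _ hd1 sI tI); have := near2 _ (box _ _ _ hd2 sI' tI').
rewrite /= E !ltr_norml => /andP[? ?] /andP[? ?].
by rewrite ler_norml; apply/andP; split; lra.
Qed.

(** * The radial profile of the cutoff *)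

Lemma bounded_on_segment (R : realType) (f : R -> R) (a b : R) :
  continuous f -> exists M, forall t, a <= t <= b -> `|f t| <= M.
Proof.
move=> cf; have /compact_bounded[M [_ mrt]] := continuous_compact
  (continuous_subspaceT cf) (@segment_compact R a b).
exists (M + 1) => t tab; apply: (mrt (M + 1)); first by rewrite ltrDl.
by exists t.
Qed.

Lemma derive1n_locally_const (R : realType) (g : R -> R) (c : R) (a b : R) :
  (forall t, a < t < b -> g t = c) ->
  forall t, a < t < b -> derive1n 1 g t = 0 /\ derive1n 2 g t = 0.
Proof.
move=> gc.
have near_ab (t : R) : a < t < b -> \forall s \near t, a < s < b.
  by move=> tab; have := @near_in_itvoo R a b t; rewrite in_itv/= tab; apply.
have g1 t : a < t < b -> derive1n 1 g t = 0.
  move=> tab; rewrite derive1n1 derive1E (near_eq_derive (g := cst c)).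
    exact: derive_cst.
  by apply: filterS (near_ab t tab) => s /gc.
move=> t tab; split; first exact: g1.
rewrite derive1nS derive1E (near_eq_derive (g := cst 0)) ?derive_cst//.
by apply: filterS (near_ab t tab) => s /g1.
Qed.

(** The properties of s(t) = rho(sqrt t) used below, with s1 and s2 its first
    two derivatives. The thresholds 1/16 and 1/4 are the squares of the radii
    1/4 and 1/2 between which rho varies. *)
Record profile (R : realType) (M : R) (s s1 s2 : R -> R) : Prop := Profile {
  profile_bound_gt0 : 0 < M;
  profile_derive1 : forall t : R, is_derive t 1 s (s1 t);
  profile_derive2 : forall t : R, is_derive t 1 s1 (s2 t);
  profile_cont2 : continuous s2;
  profile_flat : forall t, t < 16^-1 -> s1 t = 0 /\ s2 t = 0;
  profile_vanish : forall t, 4^-1 < t -> [/\ s t = 0, s1 t = 0 & s2 t = 0];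
  profile_bound1 : forall t, `|s1 t| <= M;
  profile_bound2 : forall t, `|s2 t| <= M }.

(** Away from 0 the function rho(sqrt t) is as smooth as rho; below 1/16 it is
    constant, which removes the singularity of the square root. Its first two
    derivatives are continuous and vanish outside [0, 1], hence bounded. *)
Lemma cutoff_profile (R : realType) (rho : R -> R) : cutoff rho ->
  exists M s s1 s2, profile M s s1 s2 /\ forall t, 0 <= t -> rho t = s (t ^+ 2).
Proof.
move=> [[g gs rhog] supp rho1].
have rhoE t : 0 <= t -> rho t = g t by move=> t0; apply: rhog; rewrite in_itv/= t0.
have g1E t : 0 <= t <= 4^-1 -> g t = 1.
  by move=> /andP[t0 t4]; rewrite -rhoE// rho1// in_itv/= t0.
have g0E t : 2^-1 < t -> g t = 0.
  move=> t2; have t0 : 0 <= t by rewrite (le_trans _ (ltW t2)).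
  rewrite -rhoE//; apply/eqP/negPn/negP => rt.
  have /supp : closure [set t | 0 <= t /\ rho t != 0] t.
    exact: subset_closure.
  by rewrite /= in_itv/= (leNgt t) t2 andbF.
pose g1 := derive1n 1 g; pose g2 := derive1n 2 g.
have gD (t : R) : is_derive t 1 g (g1 t).
  by split; [exact: (gs 0%N)|rewrite /g1 derive1n1 derive1E].
have gD1 (t : R) : is_derive t 1 g1 (g2 t).
  by split; [exact: (gs 1%N)|rewrite /g2 derive1nS derive1E].
have cg1 : continuous g1 := is_derive_continuous gD1.
have cg2 : continuous g2.
  by move=> t; apply/differentiable_continuous/derivable1_diffP; exact: (gs 2%N).
have gflat t : 0 < t < 4^-1 -> g1 t = 0 /\ g2 t = 0.
  apply: (derive1n_locally_const (c := 1)) => s /andP[s0 s4].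
  by rewrite g1E// !ltW.
have gvan t : 2^-1 < t -> g1 t = 0 /\ g2 t = 0.
  move=> t2; apply: (derive1n_locally_const (c := 0) (a := 2^-1) (b := t + 1)).
    by move=> s /andP[s2 _]; exact: g0E.
  by rewrite t2 ltrDl ltr01.
(* k is the derivative of the square root; at the nonpositive reals it is 0
   because the inverse of 0 is 0, which matches the flatness of s there. *)
pose k (t : R) := (2 * Num.sqrt t)^-1.
pose s (t : R) := g (Num.sqrt t).
pose s1 (t : R) := g1 (Num.sqrt t) * k t.
pose s2 (t : R) := g2 (Num.sqrt t) * k t ^+ 2 - 2 * g1 (Num.sqrt t) * k t ^+ 3.
have small t : t < 16^-1 -> [/\ s t = 1, s1 t = 0 & s2 t = 0].
  move=> t16; have [t0|t0] := leP t 0.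
    have k0 : k t = 0 by rewrite /k ler0_sqrtr// mulr0 invr0.
    rewrite /s1 /s2 k0 !expr0n !mulr0 subr0; split => //.
    by rewrite /s ler0_sqrtr// g1E// lexx invr_ge0 ler0n.
  have q0 : 0 < Num.sqrt t by rewrite sqrtr_gt0.
  have q4 : Num.sqrt t < 4^-1.
    rewrite -(@ltr_pXn2r _ 2)// ?nnegrE ?sqrtr_ge0//.
    by rewrite sqr_sqrtr ?(ltW t0)//; lra.
  have [e1 e2] : g1 (Num.sqrt t) = 0 /\ g2 (Num.sqrt t) = 0.
    by apply: gflat; rewrite q0.
  rewrite /s1 /s2 e1 e2 !(mul0r, mulr0) subr0; split => //.
  by rewrite /s g1E// !ltW.
have big t : 4^-1 < t -> [/\ s t = 0, s1 t = 0 & s2 t = 0].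
  move=> t4; have t0 : 0 <= t by rewrite (le_trans _ (ltW t4)).
  have q2 : 2^-1 < Num.sqrt t.
    rewrite -(@ltr_pXn2r _ 2)// ?nnegrE ?sqrtr_ge0//.
    by rewrite sqr_sqrtr//; lra.
  have [e1 e2] := gvan _ q2.
  by rewrite /s1 /s2 /s g0E// e1 e2 !(mul0r, mulr0) subr0.
have near_small (t : R) : t < 16^-1 -> \forall z \near t, z < 16^-1.
  exact: lt_nbhsl.
have kD (t : R) : 0 < t -> is_derive t 1 k (- 2 * k t ^+ 3).
  move=> t0; have q0 : Num.sqrt t != 0 by rewrite gt_eqF// sqrtr_gt0.
  have D : is_derive t 1 (fun z => 2 * Num.sqrt z) (2 * k t).
    exact: is_deriveZ (is_derive1_sqrt t0).
  have n0 : 2 * Num.sqrt t != 0 by rewrite mulf_neq0.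
  apply: (is_derive_eq (@is_deriveV R (fun z => 2 * Num.sqrt z) t _ 1 n0 D)).
  by rewrite /k /GRing.scale/=; field.
have sD (t : R) : is_derive t 1 s (s1 t).
  have [t16|t16] := ltP t 16^-1.
    have [_ -> _] := small t t16.
    apply: near_eq_is_derive (is_derive_cst (1 : R) t 1).
    by apply: filterS (near_small t t16) => z /small[->].
  have t0 : 0 < t by rewrite (lt_le_trans _ t16).
  exact: is_derive_chain (is_derive1_sqrt t0) (gD _).
have s1D (t : R) : is_derive t 1 s1 (s2 t).
  have [t16|t16] := ltP t 16^-1.
    have [_ _ ->] := small t t16.
    apply: near_eq_is_derive (is_derive_cst (0 : R) t 1).
    by apply: filterS (near_small t t16) => z /small[_ ->].
  have t0 : 0 < t by rewrite (lt_le_trans _ t16).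
  have D := is_derive_chain (is_derive1_sqrt t0) (gD1 _).
  apply: is_derive_eq (is_deriveM D (kD t t0)) _.
  by rewrite /s2 /GRing.scale/= -/(k t); ring.
have cs2 : continuous s2.
  move=> t; have [t16|t16] := ltP t 16^-1.
    have [_ _ s2t] := small t t16.
    rewrite /continuous_at s2t; apply: cvg_near_cst.
    by apply: filterS (near_small t t16) => z /small[_ _ ->].
  have t0 : 0 < t by rewrite (lt_le_trans _ t16).
  have q0 : 2 * Num.sqrt t != 0 by rewrite mulf_neq0// gt_eqF// sqrtr_gt0.
  have ck : {for t, continuous k}.
    by apply/differentiable_continuous/derivable1_diffP; case: (kD t t0).
  have cg (f : R -> R) : continuous f ->
      f (Num.sqrt z) @[z --> t] --> f (Num.sqrt t).
    by move=> cf; apply: continuous_comp; [exact: sqrt_continuous|exact: cf].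
  apply: cvgB.
    by apply: cvgM; [exact: cg|apply: cvgM; exact: ck].
  apply: cvgM; first by apply: cvgM; [exact: cvg_cst|exact: cg].
  by apply: cvgM; [exact: ck|apply: cvgM; exact: ck].
have [M1 b1] := bounded_on_segment 0 1 (is_derive_continuous s1D).
have [M2 b2] := bounded_on_segment 0 1 cs2.
exists (`|M1| + `|M2| + 1), s, s1, s2; split; last first.
  by move=> t t0; rewrite rhoE// /s sqrtr_sqr ger0_norm.
have out (t : R) : ~~ (0 <= t <= 1) -> s1 t = 0 /\ s2 t = 0.
  rewrite negb_and -!ltNge => /orP[t0|t1].
    by have /small[_ -> ->] : t < 16^-1 by rewrite (lt_trans t0)// invr_gt0 ltr0n.
  by have /big[_ -> ->] : 4^-1 < t by rewrite (lt_trans _ t1)// invf_lt1// ltr1n.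
have M12 : 0 <= `|M1| + `|M2| + 1 by rewrite !addr_ge0.
split => //.
- by move=> t /small[].
- move=> t; have [/b1 h|/out[-> _]] := boolP (0 <= t <= 1); last by rewrite normr0.
  by rewrite (le_trans h)// (le_trans (ler_norm _))// -addrA lerDl addr_ge0.
- move=> t; have [/b2 h|/out[_ ->]] := boolP (0 <= t <= 1); last by rewrite normr0.
  rewrite (le_trans h)// (le_trans (ler_norm _))//.
  by rewrite addrAC lerDr addr_ge0.
Qed.

(** * Components of smooth vector fields *)

(** Applied to the two projections, this reduces the derivatives of a vector
    field to those of its components. *)
Lemma is_derive_linear_comp (R : realFieldType) (V W W' : normedModType R)
    (p : {linear W -> W'}) (f : V -> W) (x v : V) (d : W) :
  continuous p -> is_derive x v f d -> is_derive x v (p \o f) (p d).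
Proof.
move=> cp [df fd].
have fd' : h^-1 *: ((f \o shift x) (h *: v) - f x) @[h --> 0^'] --> d by rewrite -fd.
have E : p \o (fun h => h^-1 *: ((f \o shift x) (h *: v) - f x)) =
    (fun h => h^-1 *: (((p \o f) \o shift x) (h *: v) - (p \o f) x)).
  by apply/funext => h /=; rewrite linearZ linearB.
have pd := cvg_comp _ _ fd' (cp d); rewrite E in pd.
by split; [apply/cvg_ex; exists (p d)|exact: cvg_lim].
Qed.

Lemma foldr_partial_linear (R : realType) (W W' : normedModType R)
    (p : {linear W -> W'}) (f : R * R -> W) (s : seq 'I_2) :
  continuous p -> smooth2 f ->
  foldr (@partial R W') (p \o f) s = p \o foldr (@partial R W) f s.
Proof.
move=> cp fs; elim: s => //= i s ->; apply/funext => y.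
have /derivableP/(is_derive_linear_comp cp) [_ E] := (fs s).2 i y.
exact: E.
Qed.

Lemma smooth2_linear (R : realType) (W W' : normedModType R)
    (p : {linear W -> W'}) (f : R * R -> W) :
  continuous p -> smooth2 f -> smooth2 (p \o f).
Proof.
move=> cp fs s /=; rewrite foldr_partial_linear//; split=> [y|i y].
  by apply: continuous_comp; [exact: (fs s).1|exact: cp].
by have /derivableP/(is_derive_linear_comp cp) [] := (fs s).2 i y.
Qed.

Lemma smooth2_fst (R : realType) (u : R * R -> R * R) :
  smooth2 u -> smooth2 ((fun z => (u z).1) : R * R -> R^o).
Proof.
by apply: (@smooth2_linear _ _ R^o fst) => y; exact: cvg_fst.
Qed.

Lemma smooth2_snd (R : realType) (u : R * R -> R * R) :
  smooth2 u -> smooth2 ((fun z => (u z).2) : R * R -> R^o).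
Proof.
by apply: (@smooth2_linear _ _ R^o snd) => y; exact: cvg_snd.
Qed.

Lemma smooth2_partial (R : realType) (W : normedModType R) (f : R * R -> W)
    (i : 'I_2) : smooth2 f -> smooth2 (partial i f).
Proof. by move=> fs s; have := fs (rcons s i); rewrite foldr_rcons. Qed.

Lemma smooth2_continuous (R : realType) (W : normedModType R)
    (f : R * R -> W) : smooth2 f -> continuous f.
Proof. by move=> /(_ [::])[]. Qed.

Lemma smooth2_is_derive (R : realType) (W : normedModType R) (f : R * R -> W)
    (i : 'I_2) (y : R * R) :
  smooth2 f -> is_derive y (basis2 R i) f (partial i f y).
Proof. by move=> /(_ [::])[_ fd]; exact/derivableP/fd. Qed.

Lemma basis2_0 (R : realType) : basis2 R 0 = (1, 0).
Proof. by rewrite /basis2 eqxx. Qed.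

Lemma basis2_1 (R : realType) : basis2 R 1 = (0, 1).
Proof. by []. Qed.

Lemma partialC (R : realType) (f : R * R -> R^o) :
  smooth2 f -> partial 1 (partial 0 f) =1 partial 0 (partial 1 f).
Proof.
move=> fs; have s0 := smooth2_partial 0 fs; have s1 := smooth2_partial 1 fs.
apply: (@schwarz _ f (partial 0 f) (partial 1 f)).
- by move=> y; rewrite -basis2_0; exact: smooth2_is_derive fs.
- by move=> y; rewrite -basis2_1; exact: smooth2_is_derive fs.
- by move=> y; rewrite -basis2_1; exact: smooth2_is_derive s0.
- by move=> y; rewrite -basis2_0; exact: smooth2_is_derive s1.
- exact: smooth2_continuous (smooth2_partial 1 s0).
- exact: smooth2_continuous (smooth2_partial 0 s1).
Qed.

(** * Integral of a rotated Hessian against a symmetric gradient *)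

Lemma is_derive_mul (R : realType) (f g : R * R -> R) (y v : R * R)
    (df dg : R) : is_derive y v f df -> is_derive y v g dg ->
  is_derive y v (fun z => f z * g z) (f y * dg + df * g y).
Proof.
by move=> fd gd; apply: is_derive_eq (is_deriveM fd gd) _; rewrite [df * _]mulrC.
Qed.

Lemma is_derive_add (R : realType) (f g : R * R -> R) (y v : R * R)
    (df dg : R) : is_derive y v f df -> is_derive y v g dg ->
  is_derive y v (fun z => f z + g z) (df + dg).
Proof. exact: is_deriveD. Qed.

Lemma is_derive_sub (R : realType) (f g : R * R -> R) (y v : R * R)
    (df dg : R) : is_derive y v f df -> is_derive y v g dg ->
  is_derive y v (fun z => f z - g z) (df - dg).
Proof. exact: is_deriveB. Qed.

Lemma is_derive_const (R : realType) (c : R) (y v : R * R) :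
  is_derive y v (fun _ => c) 0.
Proof. exact: is_derive_cst. Qed.

Lemma is_derive_fst (R : realType) (y v : R * R) :
  is_derive y v (fun z => z.1 : R) v.1.
Proof.
apply: (@is_derive_linear_comp R _ _ R^o fst id) => z; exact: cvg_fst.
Qed.

Lemma is_derive_snd (R : realType) (y v : R * R) :
  is_derive y v (fun z => z.2 : R) v.2.
Proof.
apply: (@is_derive_linear_comp R _ _ R^o snd id) => z; exact: cvg_snd.
Qed.

Section continuous_real_valued.
Variables (R : realType) (T : topologicalType).
Implicit Types f g : T -> R.

Lemma continuous_mul f g : continuous f -> continuous g ->
  continuous (fun y => f y * g y).
Proof. by move=> cf cg y; apply: cvgM; [exact: cf|exact: cg]. Qed.

Lemma continuous_add f g : continuous f -> continuous g ->
  continuous (fun y => f y + g y).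
Proof. by move=> cf cg y; apply: cvgD; [exact: cf|exact: cg]. Qed.

Lemma continuous_opp f : continuous f -> continuous (fun y => - f y).
Proof. by move=> cf y; apply: cvgN; exact: cf. Qed.

Lemma continuous_const (c : R) : continuous (fun _ : T => c).
Proof. by move=> y; exact: cvg_cst. Qed.

Lemma continuous_after (h : R -> R) f : continuous h -> continuous f ->
  continuous (fun y => h (f y)).
Proof. by move=> ch cf y; apply: continuous_comp; [exact: cf|exact: ch]. Qed.

End continuous_real_valued.

Lemma continuous_fst (R : realType) : continuous (fun y : R * R => y.1).
Proof. by move=> y; exact: cvg_fst. Qed.

Lemma continuous_snd (R : realType) : continuous (fun y : R * R => y.2).
Proof. by move=> y; exact: cvg_snd. Qed.

(** Syntax-directed on sums, products and compositions; the functions that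
    are not decomposed further must have a continuity hypothesis in the
    context. *)
Ltac continuity := repeat lazymatch goal with
  | H : continuous ?f |- continuous ?f => exact H
  | H : continuous ?f |- continuous (fun y => ?f y) => exact H
  | |- continuous (fun y => fst y) => exact: continuous_fst
  | |- continuous (fun y => snd y) => exact: continuous_snd
  | |- continuous (fun y => _ + _) => apply: continuous_add
  | |- continuous (fun y => - _) => apply: continuous_opp
  | |- continuous (fun y => _ * _) => apply: continuous_mul
  | H : continuous ?h |- continuous (fun y => ?h _) => apply: (continuous_after H)
  | |- continuous (fun y => ?c) => exact: (@continuous_const _ _ c)
  end.

Lemma ADE (R : realType) (u : R * R -> R * R) (y : R * R) :
  let u1 : R * R -> R^o := fun z => (u z).1 in
  let u2 : R * R -> R^o := fun z => (u z).2 in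
  [/\ AD u y 0 0 = partial 0 u1 y,
      AD u y 1 0 = partial 1 u1 y + partial 0 u2 y &
      AD u y 2%:R 0 = partial 1 u2 y].
Proof. by move=> u1 u2; rewrite /AD /mx_of_rows !mxE. Qed.

(** The integrand is the divergence of the field (H1, H2) of the proof: when
    that divergence is expanded, the terms in a12 and b12 cancel because each
    mixed derivative is reached in both orders. In the application (psi1, psi2)
    is the gradient of the Airy function, and (a1, a2), (b1, b2) are the
    gradients of the two components of u. *)
Lemma integral_airy (R : realType) (L : R)
    (psi1 psi2 psi11 psi12 psi22 a1 a2 a12 b1 b2 b12 : R * R -> R) :
  continuous psi1 -> continuous psi2 ->
  continuous psi11 -> continuous psi12 -> continuous psi22 ->
  continuous a1 -> continuous a2 -> continuous a12 ->
  continuous b1 -> continuous b2 -> continuous b12 ->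
  (forall y, is_derive y (basis2 R 0) psi1 (psi11 y)) ->
  (forall y, is_derive y (basis2 R 1) psi1 (psi12 y)) ->
  (forall y, is_derive y (basis2 R 0) psi2 (psi12 y)) ->
  (forall y, is_derive y (basis2 R 1) psi2 (psi22 y)) ->
  (forall y, is_derive y (basis2 R 1) a1 (a12 y)) ->
  (forall y, is_derive y (basis2 R 0) a2 (a12 y)) ->
  (forall y, is_derive y (basis2 R 1) b1 (b12 y)) ->
  (forall y, is_derive y (basis2 R 0) b2 (b12 y)) ->
  (forall y, L <= `|y| -> [/\ psi1 y = 0, psi2 y = 0 &
     [/\ psi11 y = 0, psi12 y = 0 & psi22 y = 0]]) ->
  \int[lebesgue2 R]_y
    (psi22 y * a1 y - psi12 y * (a2 y + b1 y) + psi11 y * b2 y) = 0.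
Proof.
move=> c1 c2 c11 c12 c22 ca1 ca2 ca12 cb1 cb2 cb12.
move=> d11 d12 d21 d22 da1 da2 db1 db2 van.
pose H1 y := psi1 y * b2 y - psi2 y * a2 y.
pose H2 y := psi2 y * a1 y - psi1 y * b1 y.
pose h1 y := (psi1 y * b12 y + psi11 y * b2 y) -
             (psi2 y * a12 y + psi12 y * a2 y).
pose h2 y := (psi2 y * a12 y + psi22 y * a1 y) -
             (psi1 y * b12 y + psi12 y * b1 y).
have ch1 : continuous h1 by rewrite /h1; continuity.
have ch2 : continuous h2 by rewrite /h2; continuity.
have H1d y : is_derive y (basis2 R 0) H1 (h1 y).
  exact: is_derive_sub (is_derive_mul (d11 y) (db2 y))
                       (is_derive_mul (d21 y) (da2 y)).
have H2d y : is_derive y (basis2 R 1) H2 (h2 y).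
  exact: is_derive_sub (is_derive_mul (d22 y) (da1 y))
                       (is_derive_mul (d12 y) (db1 y)).
have v1 y : L <= `|y| -> H1 y = 0 /\ h1 y = 0.
  by move=> /van[e1 e2 [e11 e12 e22]]; rewrite /H1 /h1 e1 e2 e11 e12 !mul0r !addr0 subr0.
have v2 y : L <= `|y| -> H2 y = 0 /\ h2 y = 0.
  by move=> /van[e1 e2 [e11 e12 e22]]; rewrite /H2 /h2 e1 e2 e22 e12 !mul0r !addr0 subr0.
transitivity (\int[lebesgue2 R]_y (h1 y + h2 y)).
  by apply: eq_Rintegral => y _; rewrite /h1 /h2; ring.
rewrite RintegralD//.
- by rewrite (integral_partial_eq0 ch1 H1d v1) (integral_partial_eq0 ch2 H2d v2) addr0.
- exact: integrable_continuous_vanish ch1 (fun y Ly => (v1 y Ly).2).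
- exact: integrable_continuous_vanish ch2 (fun y Ly => (v2 y Ly).2).
Qed.

(** * The derivative of the Green function *)

Lemma pnorm2E (R : realType) (x : R * R) :
  pnorm x ^+ 2 = x.1 * x.1 + x.2 * x.2.
Proof. by rewrite /pnorm sqr_sqrtr ?addr_ge0 ?sqr_ge0// !expr2. Qed.

Lemma pnorm2_gt0 (R : realType) (x : R * R) : x != 0 -> 0 < pnorm x ^+ 2.
Proof.
rewrite pnorm2E -!expr2 lt0r addr_ge0 ?sqr_ge0// andbT.
rewrite paddr_eq0 ?sqr_ge0// !expf_eq0/=; apply: contra => /andP[/eqP x1 /eqP x2].
by apply/eqP; case: x x1 x2 => a b /= -> ->.
Qed.

Definition Gnum (R : realType) (z : R * R) : 'M[R]_(2, 3) :=
  mx_of_rows 2 3 [:: [:: z.1; z.2; - z.1]; [:: - z.2; z.1; z.2]].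

Lemma Gnum_linear (R : realType) (i : 'I_2) (j : 'I_3) :
  exists a b : R, forall z, Gnum z i j = a * z.1 + b * z.2.
Proof.
rewrite /Gnum /mx_of_rows.
case: i => -[|[|//]] ilt; case: j => -[|[|[|//]]] jlt.
- by exists 1, 0 => z; rewrite mxE /=; ring.
- by exists 0, 1 => z; rewrite mxE /=; ring.
- by exists (- 1), 0 => z; rewrite mxE /=; ring.
- by exists 0, (- 1) => z; rewrite mxE /=; ring.
- by exists 1, 0 => z; rewrite mxE /=; ring.
- by exists 0, 1 => z; rewrite mxE /=; ring.
Qed.

Lemma is_derive_G (R : realType) (x v : R * R) (i : 'I_2) (j : 'I_3) :
  x != 0 ->
  is_derive x v (fun z => G z i j)
    (Gnum v i j / pnorm x ^+ 2 -
     2 * (x.1 * v.1 + x.2 * v.2) * Gnum x i j / (pnorm x ^+ 2) ^+ 2).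
Proof.
move=> x0; have [a [b ab]] := Gnum_linear R i j.
have N0 : x.1 * x.1 + x.2 * x.2 != 0 by rewrite -pnorm2E gt_eqF// pnorm2_gt0.
rewrite pnorm2E (_ : (fun z => G z i j) =
  (fun z => (z.1 * z.1 + z.2 * z.2)^-1 * (a * z.1 + b * z.2))); last first.
  by apply/funext => z; rewrite /G mxE pnorm2E -ab.
rewrite !ab.
have f1 := is_derive_fst x v; have f2 := is_derive_snd x v.
have dN := is_derive_add (is_derive_mul f1 f1) (is_derive_mul f2 f2).
have dV : is_derive x v (fun z : R * R => (z.1 * z.1 + z.2 * z.2)^-1)
    (- (x.1 * x.1 + x.2 * x.2) ^- 2 * (x.1 * v.1 + v.1 * x.1 + (x.2 * v.2 + v.2 * x.2))).
  split; first by apply: derivableV => //; case: dN.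
  by rewrite deriveV//; case: dN => _ ->.
apply: is_derive_eq (is_derive_mul dV (is_derive_add
  (is_derive_mul (is_derive_const a x v) f1)
  (is_derive_mul (is_derive_const b x v) f2))) _ => /=.
by field.
Qed.

Lemma partial_G (R : realType) (k : 'I_2) (x : R * R) (i : 'I_2) (j : 'I_3) :
  x != 0 ->
  partial k (@G R) x i j =
    Gnum (basis2 R k) i j / pnorm x ^+ 2 -
    2 * (x.1 * (basis2 R k).1 + x.2 * (basis2 R k).2) * Gnum x i j
      / (pnorm x ^+ 2) ^+ 2.
Proof.
move=> x0; rewrite /partial derive_mx.
  by rewrite mxE; case: (is_derive_G (basis2 R k) i j x0).
apply/derivable_mxP => p q.
by case: (is_derive_G (basis2 R k) p q x0).
Qed.

(** Since the numerator of G is linear, its derivative along y is its value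
    at y, and the second term comes from differentiating 1/|x|^2. *)
Lemma ydotDGE (R : realType) (y x : R * R) (i : 'I_2) (j : 'I_3) : x != 0 ->
  ydotDG y x i j = Gnum y i j / pnorm x ^+ 2 -
    2 * (x.1 * y.1 + x.2 * y.2) * Gnum x i j / (pnorm x ^+ 2) ^+ 2.
Proof.
move=> x0; rewrite /ydotDG.
have := partial_G 0 i j x0; have := partial_G 1 i j x0.
rewrite basis2_0 basis2_1.
move: (partial 0 _ x) (partial 1 _ x) => P0 P1 E1 E0.
rewrite 3!mxE E0 E1.
have [a [b ab]] := Gnum_linear R i j; rewrite !ab /=.
have N0 : pnorm x ^+ 2 != 0 by rewrite gt_eqF// pnorm2_gt0.
move: (pnorm x ^+ 2) N0 => N N0; by field.
Qed.

(** * Algebraic bounds and norms *)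

Section norm_bounds.
Variable R : realFieldType.
Implicit Types x y A B : R.

Lemma normM_le x y A B : `|x| <= A -> `|y| <= B -> `|x * y| <= A * B.
Proof. by move=> xA yB; rewrite normrM ler_pM. Qed.

Lemma normD_le x y A B : `|x| <= A -> `|y| <= B -> `|x + y| <= A + B.
Proof. by move=> xA yB; rewrite (le_trans (ler_normD _ _))// lerD. Qed.

Lemma normN_le x A : `|x| <= A -> `|- x| <= A.
Proof. by rewrite normrN. Qed.

Lemma norm_nat_le n : `|n%:R : R| <= n%:R.
Proof. by rewrite normr_nat. Qed.

Lemma norm_invnat_le n : `|n%:R^-1 : R| <= n%:R^-1.
Proof. by rewrite normfV normr_nat. Qed.
End norm_bounds.

(** Bounds the absolute value of a polynomial expression by the same
    expression in the bounds of its atoms, read from the context; the goal's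
    right-hand side may be an evar. *)
Ltac norm_bound := lazymatch goal with
  | H : is_true (`|?x| <= _) |- is_true (`|?x| <= _) => exact H
  | |- is_true (`|_ + _| <= _) => eapply normD_le; norm_bound
  | |- is_true (`|- _| <= _) => eapply normN_le; norm_bound
  | |- is_true (`|_ * _| <= _) => eapply normM_le; norm_bound
  | |- is_true (`|_%:R^-1| <= _) => eapply norm_invnat_le
  | |- is_true (`|_%:R| <= _) => eapply norm_nat_le
  end.

(** The general homogeneous harmonic cubic, c/6 Re z^3 + d/6 Im z^3 with
    z = a + i b; [cubic1] and [cubic2] are its partial derivatives in a
    and b. *)
Definition cubic (R : fieldType) (c d a b : R) : R :=
  6^-1 * (c * (a * a * a - 3 * a * b * b) + d * (3 * a * a * b - b * b * b)).
Definition cubic1 (R : fieldType) (c d a b : R) : R :=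
  c * 2^-1 * (a * a - b * b) + d * a * b.
Definition cubic2 (R : fieldType) (c d a b : R) : R :=
  d * 2^-1 * (a * a - b * b) - c * a * b.

Lemma cubic_bounds (R : realFieldType) (c d a b : R) :
  `|c| <= 1 -> `|d| <= 1 -> `|a| <= 1 -> `|b| <= 1 ->
  [/\ `|cubic c d a b| <= 2, `|cubic1 c d a b| <= 2 & `|cubic2 c d a b| <= 2].
Proof.
move=> c1 d1 a1 b1; rewrite /cubic /cubic1 /cubic2; split.
- by eapply le_trans; [norm_bound|lra].
- by eapply le_trans; [norm_bound|lra].
- by eapply le_trans; [norm_bound|lra].
Qed.

(** The three entries of the defect after rescaling to r = 1: t1 and t2 stand
    for the first two derivatives of the radial profile, so that the factors
    t1 * 2 * a and t2 * 4 * a * b + ... are the first and second derivatives of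
    s(a^2 + b^2). The constant 20 comes from bounding each cubic by 2. *)
Lemma defect_bounds (R : realFieldType) (M c d a b t1 t2 : R) :
  `|c| <= 1 -> `|d| <= 1 -> `|a| <= 1 -> `|b| <= 1 ->
  `|t1| <= M -> `|t2| <= M ->
  [/\ `|(t2 * 4 * a * a + t1 * 2) * cubic c d a b
        + 2 * (t1 * 2 * a) * cubic1 c d a b| <= 20 * M,
      `|(t2 * 4 * a * b) * cubic c d a b
        + t1 * 2 * a * cubic2 c d a b + t1 * 2 * b * cubic1 c d a b| <= 20 * M &
      `|(t2 * 4 * b * b + t1 * 2) * cubic c d a b
        + 2 * (t1 * 2 * b) * cubic2 c d a b| <= 20 * M].
Proof.
move=> c1 d1 a1 b1 t1M t2M; have [p0 p1 p2] := cubic_bounds c1 d1 a1 b1.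
have M0 : 0 <= M by exact: le_trans t1M.
split.
- by eapply le_trans; [norm_bound|lra].
- by eapply le_trans; [norm_bound|lra].
- by eapply le_trans; [norm_bound|lra].
Qed.

Lemma norm_le_vnorm (R : realType) (n : nat) (v : 'cV[R]_n) (i : 'I_n) :
  `|v i 0| <= vnorm v.
Proof.
rewrite -sqrtr_sqr ler_sqrt ?sumr_ge0// => [|j _]; last exact: sqr_ge0.
by rewrite (bigD1 i)//= lerDl sumr_ge0// => j _; exact: sqr_ge0.
Qed.

Lemma vnorm2_le (R : realType) (v : 'cV[R]_2) :
  vnorm v <= `|v 0 0| + `|v 1 0|.
Proof.
rewrite /vnorm -(ler_pXn2r (n := 2))// ?nnegrE ?sqrtr_ge0 ?addr_ge0//.
rewrite sqr_sqrtr ?sumr_ge0// => [|j _]; last exact: sqr_ge0.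
rewrite big_ord_recl big_ord1 sqrrD !real_normK ?num_real//.
rewrite (_ : lift ord0 ord0 = 1); last exact/val_inj.
by rewrite -addrA lerD2l lerDr mulrn_wge0// mulr_ge0.
Qed.

Lemma continuous_pnorm (R : realType) : continuous (@pnorm R).
Proof.
have cq := @sqrt_continuous R; have c1 := @continuous_fst R.
have c2 := @continuous_snd R.
rewrite (_ : @pnorm R = fun y => Num.sqrt (y.1 * y.1 + y.2 * y.2)).
  by apply: (continuous_after cq); continuity.
by apply/funext => y; rewrite /pnorm !expr2.
Qed.

Lemma continuous_vnorm (R : realType) (n : nat) (v : R * R -> 'cV[R]_n) :
  (forall i, continuous (fun y => v y i 0)) -> continuous (fun y => vnorm (v y)).
Proof.
move=> cv; apply: continuous_after; first exact: sqrt_continuous.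
have csq i : continuous (fun y => v y i 0 ^+ 2).
  exact: continuous_after (@exprn_continuous R 2) (cv i).
by apply: continuous_big => // y; exact: add_continuous.
Qed.

(** * Harmonic cubics and the annulus *)

Lemma is_derive_cubic (R : realType) (c d : R) (y v : R * R) :
  is_derive y v (fun z => cubic c d z.1 z.2)
    (cubic1 c d y.1 y.2 * v.1 + cubic2 c d y.1 y.2 * v.2).
Proof.
have f1 := is_derive_fst y v; have f2 := is_derive_snd y v.
have k := fun e : R => is_derive_const e y v.
apply: is_derive_eq (is_derive_mul (k 6^-1) (is_derive_add
  (is_derive_mul (k c) (is_derive_sub
    (is_derive_mul (is_derive_mul f1 f1) f1)
    (is_derive_mul (is_derive_mul (is_derive_mul (k 3) f1) f2) f2)))
  (is_derive_mul (k d) (is_derive_sub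
    (is_derive_mul (is_derive_mul (is_derive_mul (k 3) f1) f1) f2)
    (is_derive_mul (is_derive_mul f2 f2) f2))))) _.
by rewrite /cubic1 /cubic2 /=; field.
Qed.

Lemma is_derive_cubic1 (R : realType) (c d : R) (y v : R * R) :
  is_derive y v (fun z => cubic1 c d z.1 z.2)
    ((c * y.1 + d * y.2) * v.1 + (d * y.1 - c * y.2) * v.2).
Proof.
have f1 := is_derive_fst y v; have f2 := is_derive_snd y v.
have k := fun e : R => is_derive_const e y v.
apply: is_derive_eq (is_derive_add
  (is_derive_mul (k (c * 2^-1))
    (is_derive_sub (is_derive_mul f1 f1) (is_derive_mul f2 f2)))
  (is_derive_mul (is_derive_mul (k d) f1) f2)) _.
by rewrite /=; field.
Qed.

Lemma is_derive_cubic2 (R : realType) (c d : R) (y v : R * R) :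
  is_derive y v (fun z => cubic2 c d z.1 z.2)
    ((d * y.1 - c * y.2) * v.1 - (c * y.1 + d * y.2) * v.2).
Proof.
have f1 := is_derive_fst y v; have f2 := is_derive_snd y v.
have k := fun e : R => is_derive_const e y v.
apply: is_derive_eq (is_derive_sub
  (is_derive_mul (k (d * 2^-1))
    (is_derive_sub (is_derive_mul f1 f1) (is_derive_mul f2 f2)))
  (is_derive_mul (is_derive_mul (k c) f1) f2)) _.
by rewrite /=; field.
Qed.

Definition annulus (R : realType) (r : R) : set (R * R) :=
  [set y | 4^-1 <= pnorm y / r <= 2^-1].

Lemma measurable_annulus (R : realType) (r : R) :
  measurable (annulus r : set (measurableTypeR R * measurableTypeR R)).
Proof.
have cp : continuous (fun y : R * R => pnorm y / r).
  by apply: continuous_mul; [exact: continuous_pnorm|exact: continuous_const].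
have mp := continuous_measurable_fun2 cp.
rewrite (_ : annulus r = setT `&` (fun y => pnorm y / r) @^-1` `[4^-1, 2^-1]).
  by apply: mp => //; exact: measurable_itv.
by rewrite setTI; apply/seteqP; split => y /=; rewrite in_itv.
Qed.

Lemma norm_le_pnorm (R : realType) (y : R * R) :
  `|y.1| <= pnorm y /\ `|y.2| <= pnorm y.
Proof.
by split; rewrite -sqrtr_sqr ler_sqrt ?addr_ge0 ?sqr_ge0// (lerDl, lerDr) sqr_ge0.
Qed.

Lemma norm_le_annulus (R : realType) (r : R) (y : R * R) : 0 < r ->
  annulus r y -> `|y.1| <= r /\ `|y.2| <= r.
Proof.
move=> r0 /andP[_]; rewrite ler_pdivrMr// => yr.
have [y1 y2] := norm_le_pnorm y.
by split; lra.
Qed.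

Lemma integrable_annulus (R : realType) (r : R) (f : R * R -> R) : 0 < r ->
  continuous f -> (lebesgue2 R).-integrable (annulus r) (EFin \o f).
Proof.
move=> r0 cf; apply: integrableS (integrable_continuous_square r cf).
- by apply: measurableX; exact: measurable_itv.
- exact: measurable_annulus.
- move=> y /(norm_le_annulus r0)[y1 y2].
  by split; rewrite /= in_itv/= -ler_norml.
Qed.

(** * The cutoff Airy function *)

(** The function psi = S * p is the cutoff Airy function; q1, q2 and q11, q12,
    q22 are the first and second derivatives of the cutoff S, and p1, p2, p11,
    p12, - p11 those of the harmonic cubic p. *)
Section cutoff_cubic.
Variables (R : realType) (M : R) (s s1 s2 : R -> R).
Hypothesis prof : profile M s s1 s2.
Variables (r c d : R).
Hypotheses (r0 : 0 < r) (cr : `|c| <= (r ^+ 2)^-1) (dr : `|d| <= (r ^+ 2)^-1).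

Let T (y : R * R) : R := (y.1 * y.1 + y.2 * y.2) * (r ^+ 2)^-1.
Let S (y : R * R) := s (T y).
Let p (y : R * R) := cubic c d y.1 y.2.
Let p1 (y : R * R) := cubic1 c d y.1 y.2.
Let p2 (y : R * R) := cubic2 c d y.1 y.2.
Let p11 (y : R * R) := c * y.1 + d * y.2.
Let p12 (y : R * R) := d * y.1 - c * y.2.
Let q1 (y : R * R) := s1 (T y) * (2 * (r ^+ 2)^-1 * y.1).
Let q2 (y : R * R) := s1 (T y) * (2 * (r ^+ 2)^-1 * y.2).
Let q11 (y : R * R) := s2 (T y) * (2 * (r ^+ 2)^-1 * y.1) * (2 * (r ^+ 2)^-1 * y.1)
  + s1 (T y) * (2 * (r ^+ 2)^-1).
Let q12 (y : R * R) := s2 (T y) * (2 * (r ^+ 2)^-1 * y.1) * (2 * (r ^+ 2)^-1 * y.2).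
Let q22 (y : R * R) := s2 (T y) * (2 * (r ^+ 2)^-1 * y.2) * (2 * (r ^+ 2)^-1 * y.2)
  + s1 (T y) * (2 * (r ^+ 2)^-1).

Let TE y : T y = (pnorm y / r) ^+ 2.
Proof. by rewrite /T expr_div_n pnorm2E. Qed.

Let dT y v : is_derive y v T (2 * (r ^+ 2)^-1 * y.1 * v.1 + 2 * (r ^+ 2)^-1 * y.2 * v.2).
Proof.
have f1 := is_derive_fst y v; have f2 := is_derive_snd y v.
apply: is_derive_eq (is_derive_mul (is_derive_add (is_derive_mul f1 f1)
  (is_derive_mul f2 f2)) (is_derive_const (r ^+ 2)^-1 y v)) _.
by rewrite /=; ring.
Qed.

Let dS y v : is_derive y v S (q1 y * v.1 + q2 y * v.2).
Proof.
apply: is_derive_eq (is_derive_chain (dT y v) (profile_derive1 prof (T y))) _.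
by rewrite /q1 /q2; ring.
Qed.

Let ds1 y v : is_derive y v (s1 \o T)
  (s2 (T y) * (2 * (r ^+ 2)^-1 * y.1 * v.1 + 2 * (r ^+ 2)^-1 * y.2 * v.2)).
Proof. exact: is_derive_chain (dT y v) (profile_derive2 prof (T y)). Qed.

Let dq1 y v : is_derive y v q1 (q11 y * v.1 + q12 y * v.2).
Proof.
apply: is_derive_eq (is_derive_mul (ds1 y v)
  (is_derive_mul (is_derive_const _ y v) (is_derive_fst y v))) _.
by rewrite /q11 /q12 /=; ring.
Qed.

Let dq2 y v : is_derive y v q2 (q12 y * v.1 + q22 y * v.2).
Proof.
apply: is_derive_eq (is_derive_mul (ds1 y v)
  (is_derive_mul (is_derive_const _ y v) (is_derive_snd y v))) _.
by rewrite /q22 /q12 /=; ring.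
Qed.

Let psi1 y := q1 y * p y + S y * p1 y.
Let psi2 y := q2 y * p y + S y * p2 y.
Let psi11 y := q11 y * p y + 2 * q1 y * p1 y + S y * p11 y.
Let psi12 y := q12 y * p y + q1 y * p2 y + q2 y * p1 y + S y * p12 y.
Let psi22 y := q22 y * p y + 2 * q2 y * p2 y - S y * p11 y.

Let dpsi1 y v : is_derive y v psi1 (psi11 y * v.1 + psi12 y * v.2).
Proof.
apply: is_derive_eq (is_derive_add
  (is_derive_mul (dq1 y v) (is_derive_cubic c d y v))
  (is_derive_mul (dS y v) (is_derive_cubic1 c d y v))) _.
by rewrite /psi11 /psi12 /p /p1 /p2 /p11 /p12; ring.
Qed.

Let dpsi2 y v : is_derive y v psi2 (psi12 y * v.1 + psi22 y * v.2).
Proof.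
apply: is_derive_eq (is_derive_add
  (is_derive_mul (dq2 y v) (is_derive_cubic c d y v))
  (is_derive_mul (dS y v) (is_derive_cubic2 c d y v))) _.
by rewrite /psi22 /psi12 /p /p1 /p2 /p11 /p12; ring.
Qed.

Let van y : r <= `|y| -> [/\ s (T y) = 0, s1 (T y) = 0 & s2 (T y) = 0].
Proof.
move=> ry; apply: (profile_vanish prof); rewrite TE.
have h : 1 <= pnorm y / r.
  rewrite ler_pdivlMr// mul1r (le_trans ry)// prod_normE/= ge_max.
  by apply/andP; exact: norm_le_pnorm.
by rewrite (@lt_le_trans _ _ 1)// ?invf_lt1 ?ltr1n// exprn_ege1.
Qed.

(** What is left of S (- p11, - p12, p11) paired with (v1, v2, v3) after
    subtracting (psi22, - psi12, psi11) paired with the same vector: no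
    undifferentiated S survives. *)
Let defect (v1 v2 v3 : R * R -> R) y : R :=
  - ((q22 y * p y + 2 * q2 y * p2 y) * v1 y)
  + (q12 y * p y + q1 y * p2 y + q2 y * p1 y) * v2 y
  - (q11 y * p y + 2 * q1 y * p1 y) * v3 y.

Let defect_out v1 v2 v3 y : ~ annulus r y -> defect v1 v2 v3 y = 0.
Proof.
move=> yA; suff [e1 e2] : s1 (T y) = 0 /\ s2 (T y) = 0.
  by rewrite /defect /q1 /q2 /q11 /q12 /q22 e1 e2; ring.
have t0 : 0 <= pnorm y / r by rewrite divr_ge0 ?sqrtr_ge0// ltW.
rewrite TE; have [t4|t4] := ltP (pnorm y / r) 4^-1.
  apply: (profile_flat prof); rewrite (_ : 16^-1 = 4^-1 ^+ 2).
    by rewrite ltr_pXn2r// nnegrE.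
  by field.
have [t2|t2] := leP (pnorm y / r) 2^-1; first by case: yA; rewrite /annulus/= t4.
have [//|_ -> ->//] := profile_vanish prof (t := (pnorm y / r) ^+ 2).
rewrite (_ : 4^-1 = 2^-1 ^+ 2); last by field.
by rewrite ltr_pXn2r// nnegrE.
Qed.

Let defect_le v1 v2 v3 V y : annulus r y ->
  `|v1 y| <= V -> `|v2 y| <= V -> `|v3 y| <= V ->
  `|defect v1 v2 v3 y| <= 60 * M / r * V.
Proof.
move=> /(norm_le_annulus r0)[y1 y2] v1V v2V v3V.
have rn0 : r != 0 by rewrite gt_eqF.
have rr0 : 0 < r ^+ 2 by rewrite exprn_gt0.
have scaled (z : R) : `|z| <= (r ^+ 2)^-1 -> `|z * r ^+ 2| <= 1.
  by rewrite normrM (gtr0_norm rr0) -ler_pdivlMr// mul1r.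
have divided (z : R) : `|z| <= r -> `|z / r| <= 1.
  by rewrite normrM normfV (gtr0_norm r0) ler_pdivrMr// mul1r.
have [b11 b12 b22] := defect_bounds (scaled c cr) (scaled d dr)
  (divided _ y1) (divided _ y2) (profile_bound1 prof (T y))
  (profile_bound2 prof (T y)).
have V0 : 0 <= V by exact: le_trans v1V.
set k11 := (X in `|X| <= _) in b11; set k12 := (X in `|X| <= _) in b12.
set k22 := (X in `|X| <= _) in b22.
have -> : defect v1 v2 v3 y = r^-1 * (- (k22 * v1 y) + k12 * v2 y - k11 * v3 y).
  rewrite /defect /q1 /q2 /q11 /q12 /q22 /k11 /k12 /k22 /p /p1 /p2.
  rewrite /cubic /cubic1 /cubic2.
  move: (s1 (T y)) (s2 (T y)) => t1 t2.
  by field.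
rewrite normrM normfV (gtr0_norm r0).
rewrite (_ : 60 * M / r * V = r^-1 * (20 * M * V + 20 * M * V + 20 * M * V)); last first.
  by field.
by apply: ler_wpM2l; [rewrite invr_ge0 ltW|norm_bound].
Qed.

Let cT : continuous T.
Proof.
by have c1 := @continuous_fst R; have c2 := @continuous_snd R; rewrite /T; continuity.
Qed.

(** The left-hand integrand equals the defect plus the pairing of A(D)u with
    the rotated Hessian of psi, whose integral is 0; the defect lives in the
    annulus and has size M / r there. *)
Lemma integral_cutoff_cubic (u : R * R -> R * R) : smooth2 u ->
  `|\int[lebesgue2 R]_y (s ((pnorm y / r) ^+ 2) *
      (- (c * y.1 + d * y.2) * AD u y 0 0 - (d * y.1 - c * y.2) * AD u y 1 0
       + (c * y.1 + d * y.2) * AD u y 2%:R 0))| <=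
  60 * M / r * \int[lebesgue2 R]_(y in annulus r) vnorm (AD u y).
Proof.
move=> us.
pose u1 : R * R -> R^o := fun z => (u z).1.
pose u2 : R * R -> R^o := fun z => (u z).2.
have us1 : smooth2 u1 := smooth2_fst us.
have us2 : smooth2 u2 := smooth2_snd us.
pose a1 : R * R -> R := partial 0 u1; pose a2 : R * R -> R := partial 1 u1.
pose b1 : R * R -> R := partial 0 u2; pose b2 : R * R -> R := partial 1 u2.
pose a12 : R * R -> R := partial 1 (partial 0 u1).
pose b12 : R * R -> R := partial 1 (partial 0 u2).
have ca1 : continuous a1 := smooth2_continuous (smooth2_partial 0 us1).
have ca2 : continuous a2 := smooth2_continuous (smooth2_partial 1 us1).
have cb1 : continuous b1 := smooth2_continuous (smooth2_partial 0 us2).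
have cb2 : continuous b2 := smooth2_continuous (smooth2_partial 1 us2).
have ca12 : continuous a12.
  exact: smooth2_continuous (smooth2_partial 1 (smooth2_partial 0 us1)).
have cb12 : continuous b12.
  exact: smooth2_continuous (smooth2_partial 1 (smooth2_partial 0 us2)).
have da1 y : is_derive y (basis2 R 1) a1 (a12 y).
  exact: smooth2_is_derive (smooth2_partial 0 us1).
have db1 y : is_derive y (basis2 R 1) b1 (b12 y).
  exact: smooth2_is_derive (smooth2_partial 0 us2).
have da2 y : is_derive y (basis2 R 0) a2 (a12 y).
  rewrite /a12 (partialC us1); exact: smooth2_is_derive (smooth2_partial 1 us1).
have db2 y : is_derive y (basis2 R 0) b2 (b12 y).
  rewrite /b12 (partialC us2); exact: smooth2_is_derive (smooth2_partial 1 us2).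
have A0 y : AD u y 0 0 = a1 y by case: (ADE u y).
have A1 y : AD u y 1 0 = a2 y + b1 y by case: (ADE u y).
have A2 y : AD u y 2%:R 0 = b2 y by case: (ADE u y).
clearbody a1 a2 b1 b2 a12 b12; clear us1 us2 u1 u2.
have cy1 := @continuous_fst R; have cy2 := @continuous_snd R.
have cs : continuous s := is_derive_continuous (profile_derive1 prof).
have cs1 : continuous s1 := is_derive_continuous (profile_derive2 prof).
have cs2 : continuous s2 := profile_cont2 prof.
have cS : continuous S by rewrite /S; continuity.
have cp : continuous p by rewrite /p /cubic; continuity.
have cp1 : continuous p1 by rewrite /p1 /cubic1; continuity.
have cp2 : continuous p2 by rewrite /p2 /cubic2; continuity.
have cp11 : continuous p11 by rewrite /p11; continuity.
have cp12 : continuous p12 by rewrite /p12; continuity.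
have cq1 : continuous q1 by rewrite /q1; continuity.
have cq2 : continuous q2 by rewrite /q2; continuity.
have cq11 : continuous q11 by rewrite /q11; continuity.
have cq12 : continuous q12 by rewrite /q12; continuity.
have cq22 : continuous q22 by rewrite /q22; continuity.
have cpsi1 : continuous psi1 by rewrite /psi1; continuity.
have cpsi2 : continuous psi2 by rewrite /psi2; continuity.
have cpsi11 : continuous psi11 by rewrite /psi11; continuity.
have cpsi12 : continuous psi12 by rewrite /psi12; continuity.
have cpsi22 : continuous psi22 by rewrite /psi22; continuity.
have psi_van y : r <= `|y| -> [/\ psi1 y = 0, psi2 y = 0 &
    [/\ psi11 y = 0, psi12 y = 0 & psi22 y = 0]].
  move=> /van[e e1 e2].
  rewrite /psi1 /psi2 /psi11 /psi12 /psi22 /q1 /q2 /q11 /q12 /q22 /S e e1 e2.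
  by split; [ring|ring|split; ring].
pose airy y := psi22 y * a1 y - psi12 y * (a2 y + b1 y) + psi11 y * b2 y.
have int_airy : \int[lebesgue2 R]_y airy y = 0.
  apply: (integral_airy cpsi1 cpsi2 cpsi11 cpsi12 cpsi22 ca1 ca2 ca12 cb1 cb2
    cb12 _ _ _ _ da1 da2 db1 db2 psi_van) => y.
  - by apply: is_derive_eq (dpsi1 y _) _; rewrite basis2_0/=; ring.
  - by apply: is_derive_eq (dpsi1 y _) _; rewrite basis2_1/=; ring.
  - by apply: is_derive_eq (dpsi2 y _) _; rewrite basis2_0/=; ring.
  - by apply: is_derive_eq (dpsi2 y _) _; rewrite basis2_1/=; ring.
have cairy : continuous airy by rewrite /airy; continuity.
have airy_van y : r <= `|y| -> airy y = 0.
  by move=> /psi_van[_ _ [e11 e12 e22]]; rewrite /airy e11 e12 e22; ring.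
pose K := defect a1 (fun y => a2 y + b1 y) b2.
have cK : continuous K by rewrite /K /defect; continuity.
have K_van y : r <= `|y| -> K y = 0.
  move=> /van[_ e1 e2].
  by rewrite /K /defect /q1 /q2 /q11 /q12 /q22 e1 e2; ring.
have -> : \int[lebesgue2 R]_y (s ((pnorm y / r) ^+ 2) *
      (- (c * y.1 + d * y.2) * AD u y 0 0 - (d * y.1 - c * y.2) * AD u y 1 0
       + (c * y.1 + d * y.2) * AD u y 2%:R 0)) = \int[lebesgue2 R]_y (K y + airy y).
  apply: eq_Rintegral => y _; rewrite A0 A1 A2 -TE /K /defect /airy.
  by rewrite /psi22 /psi12 /psi11 /S /p11 /p12; ring.
rewrite RintegralD//; last 2 first.
- exact: integrable_continuous_vanish cK K_van.
- exact: integrable_continuous_vanish cairy airy_van.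
rewrite int_airy addr0.
have KA : K = K \_ (annulus r).
  apply/funext => y; rewrite patchE; case: ifPn => //.
  by rewrite notin_setE; exact: defect_out.
have -> : \int[lebesgue2 R]_y K y = \int[lebesgue2 R]_(y in annulus r) K y.
  by rewrite {1}KA -Rintegral_mkcond.
have mA := measurable_annulus r.
have cv : continuous (fun y => vnorm (AD u y)).
  apply: continuous_vnorm => -[[|[|[|//]]] i3].
  - rewrite (_ : (fun y => _) = a1)//; apply/funext => y; rewrite -A0.
    by congr (AD u y _ _); exact/val_inj.
  - rewrite (_ : (fun y => _) = fun y => a2 y + b1 y); first by continuity.
    by apply/funext => y; rewrite -A1; congr (AD u y _ _); exact/val_inj.
  - rewrite (_ : (fun y => _) = b2)//; apply/funext => y; rewrite -A2.
    by congr (AD u y _ _); exact/val_inj.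
have iK := integrable_annulus r0 cK.
have iv := integrable_annulus r0 cv.
rewrite (le_trans (le_normr_Rintegral mA iK))// -RintegralZl//.
apply: le_Rintegral => //.
- by have /integrable_norm := iK.
- by have /(integrableZl mA (60 * M / r)) := iv.
- move=> y Ay; apply: defect_le => //.
  + by rewrite -A0; exact: norm_le_vnorm.
  + by rewrite -A1; exact: norm_le_vnorm.
  + by rewrite -A2; exact: norm_le_vnorm.
Qed.

End cutoff_cubic.

(** * The estimate *)

(** The rows of y.DG(x) are rotated Hessians of harmonic cubics. Writing
    e = x1^2 - x2^2 and f = 2 x1 x2 for the real and imaginary parts of x^2,
    the coefficients (c, d) are (e, f) / |x|^4 for the first row and
    (- f, e) / |x|^4 for the second. *)
Lemma ydotDG_mulmx (R : realType) (x : R * R) (i : 'I_2) : x != 0 ->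
  exists c d : R, [/\ `|c| <= (pnorm x ^+ 2)^-1, `|d| <= (pnorm x ^+ 2)^-1 &
    forall (y : R * R) (v : 'cV[R]_3), (ydotDG y x *m v) i 0 =
      - (c * y.1 + d * y.2) * v 0 0 - (d * y.1 - c * y.2) * v 1 0
      + (c * y.1 + d * y.2) * v 2%:R 0].
Proof.
move=> x0; have N0 := pnorm2_gt0 x0.
have bound (z : R) : `|z| <= pnorm x ^+ 2 ->
    `|z / (pnorm x ^+ 2) ^+ 2| <= (pnorm x ^+ 2)^-1.
  move=> zN; rewrite normrM normfV (gtr0_norm (exprn_gt0 2 N0)).
  rewrite ler_pdivrMr; last exact: exprn_gt0.
  by rewrite [X in _ <= X](_ : _ = pnorm x ^+ 2)// [X in _ * X]expr2 mulKf// gt_eqF.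
pose e := x.1 * x.1 - x.2 * x.2; pose f := 2 * x.1 * x.2.
have eN : `|e| <= pnorm x ^+ 2.
  by rewrite pnorm2E ler_norml /e; apply/andP; split; nra.
have fN : `|f| <= pnorm x ^+ 2.
  have := sqr_ge0 (x.1 - x.2); have := sqr_ge0 (x.1 + x.2).
  by rewrite pnorm2E ler_norml /f !expr2 => ? ?; apply/andP; split; nra.
have NE := pnorm2E x.
have rowE (j : 'I_2) (z : R * R) (v : 'cV[R]_3) : (ydotDG z x *m v) j 0 =
    ydotDG z x j 0 * v 0 0 + ydotDG z x j 1 * v 1 0 + ydotDG z x j 2%:R * v 2%:R 0.
  rewrite mxE !big_ord_recl big_ord0 addr0 addrA.
  by congr (_ + _ * _ + _ * _); congr (_ _ _); exact/val_inj.
case: i => -[|[|//]] i2.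
- exists (e / (pnorm x ^+ 2) ^+ 2), (f / (pnorm x ^+ 2) ^+ 2).
  split; [exact: bound|exact: bound|move=> z v].
  rewrite (_ : Ordinal i2 = 0); last exact/val_inj.
  rewrite rowE !ydotDGE// /Gnum /mx_of_rows !mxE /= /e /f.
  move: (v 0 0) (v 1 0) (v 2%:R 0) => v0 v1 v2.
  rewrite NE in N0 *.
  by field; rewrite gt_eqF.
- exists (- f / (pnorm x ^+ 2) ^+ 2), (e / (pnorm x ^+ 2) ^+ 2).
  split; [by apply: bound; rewrite normrN|exact: bound|move=> z v].
  rewrite (_ : Ordinal i2 = 1); last exact/val_inj.
  rewrite rowE !ydotDGE// /Gnum /mx_of_rows !mxE /= /e /f.
  move: (v 0 0) (v 1 0) (v 2%:R 0) => v0 v1 v2.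
  rewrite NE in N0 *.
  by field; rewrite gt_eqF.
Qed.

Theorem lemma5p3 (R : realType) (rho : R -> R) (hrho : cutoff rho) :
  exists2 C : R, 0 < C &
    forall x : R * R, x != 0 ->
    forall u : R * R -> R * R, test_field u ->
      vnorm (vintegral (fun y => rho (pnorm y / pnorm x) *:
                                   (ydotDG y x *m AD u y)))
      <= C / pnorm x *
         \int[lebesgue2 R]_(y in [set y : R * R |
              4^-1 <= pnorm y / pnorm x <= 2^-1]) vnorm (AD u y).
Proof.
have [M [s [s1 [s2 [prof rhoE]]]]] := cutoff_profile hrho.
exists (120 * M); first by rewrite mulr_gt0// (profile_bound_gt0 prof).
move=> x x0 u [us _].
have r0 : 0 < pnorm x.
  by have := pnorm2_gt0 x0; rewrite exprn_even_gt0//= lt0r sqrtr_ge0 andbT.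
set v := vintegral _; set I := \int[_]_(_ in _) _.
have row (i : 'I_2) : `|v i 0| <= 60 * M / pnorm x * I.
  have [c [d [cN dN rowE]]] := ydotDG_mulmx i x0.
  have := integral_cutoff_cubic prof r0 cN dN us.
  congr (`|_| <= _); rewrite /v /vintegral mxE.
  apply: eq_Rintegral => y _; rewrite -rowE -rhoE ?divr_ge0 ?sqrtr_ge0//.
  by rewrite [RHS]mxE.
rewrite (le_trans (vnorm2_le v))// (le_trans (lerD (row 0) (row 1)))//.
by rewrite le_eqVlt; apply/orP; left; apply/eqP; field; rewrite gt_eqF.
Qed.
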